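(* (i) $\mathrm{DC}_n \subsetneq \mathrm{DC}_{n+1}$ for every $n\in\mathbb{N}$, and (ii) $\bigcup_{n\in\mathbb{N}}\mathrm{DC}_n \subsetneq \mathrm{DC}_\omega$. These inclusions are strict also when the classes are restricted to countable systems.
   Context: Consider ARSs with two relations $\mathcal{A}=(A,\to,\leadsto)$, $A$ non-empty, ${\to},{\leadsto}\subseteq A\times A$. For an ordinal $\alpha$, $\mathcal{A}$ belongs to the class $\mathrm{DC}_\alpha$ (decreasing commuting with $\alpha$ labels) if there are families $(\to_\gamma)_{\gamma<\alpha}$ and $(\leadsto_\gamma)_{\gamma<\alpha}$ of relations on $A$ with $\bigcup_\gamma{\to_\gamma}={\to}$ and $\bigcup_\gamma{\leadsto_\gamma}={\leadsto}$ such that for every peak $a\to_\beta c$, $a\leadsto_\gamma b$ (with $\beta,\gamma<\alpha$) there exists $d$ with $b \twoheadrightarrow_{<\gamma}\cdot \to^{\equiv}_{\beta}\cdot \twoheadrightarrow_{<\gamma\cup<\beta} d$ (steps of $\to$) and $c \leadsto^*_{<\beta}\cdot \leadsto^{\equiv}_{\gamma}\cdot \leadsto^*_{<\gamma\cup<\beta} d$ (steps of $\leadsto$). Here ${\to_{<\delta}}=\bigcup_{\epsilon<\delta}{\to_\epsilon}$, ${\to_{<\gamma\cup<\beta}}={\to_{<\gamma}}\cup{\to_{<\beta}}$, similarly for $\leadsto$; $\twoheadrightarrow_X$ and $\leadsto^*_X$ are reflexive transitive closures, and $R^{\equiv}$ is $R$ union the identity. An ARS is countable if its carrier set is countable. 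*)

(* Defs.v *)
From Stdlib Require Export Relations Wellfounded FinFun.
From Stdlib Require Import Arith Peano_dec.

(* An ordinal is given by a strict well-order of that order type; its elements
   play the role of the ordinals below it. *)
Record ordinal : Type := Ordinal {
  label :> Type;
  olt : relation label;
  olt_wf : well_founded olt;
  olt_trans : transitive label olt;
  olt_total : forall x y : label, olt x y \/ x = y \/ olt y x
}.
Arguments olt {_} _ _.

Definition omega : ordinal.
Proof.
  refine (@Ordinal nat lt lt_wf Nat.lt_trans _).
  exact Nat.lt_total.
Defined.

Definition fin (n : nat) : ordinal.
Proof.
  refine (@Ordinal {m : nat | m < n}
            (fun x y => proj1_sig x < proj1_sig y) _ _ _).
  - exact (wf_inverse_image _ _ lt (fun x => proj1_sig x) lt_wf).
  - intros x y z; apply Nat.lt_trans.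
  - intros [x hx] [y hy]; simpl.
    destruct (Nat.lt_total x y) as [h | [h | h]].
    + left; exact h.
    + right; left; subst y; f_equal; apply le_unique.
    + right; right; exact h.
Defined.

Record ARS : Type := mkARS {
  carrier :> Type;
  carrier_inhabited : inhabited carrier;
  red : relation carrier;    (* the relation -> *)
  wred : relation carrier    (* the relation ~> *)
}.

Definition compose {A : Type} (R S : relation A) : relation A :=
  fun x z => exists y, R x y /\ S y z.

Definition Union {I A : Type} (R : I -> relation A) : relation A :=
  fun x y => exists i, R i x y.

Definition below {alpha : ordinal} {A : Type} (R : alpha -> relation A)
    (delta : alpha) : relation A :=
  fun x y => exists epsilon, olt epsilon delta /\ R epsilon x y.

Definition below2 {alpha : ordinal} {A : Type} (R : alpha -> relation A)
    (gamma beta : alpha) : relation A :=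
  union A (below R gamma) (below R beta).

(* The side of a decreasing diagram opposite to a step labelled [beta],
   starting at the target of a step labelled [gamma]. *)
Definition decreasing_side {alpha : ordinal} {A : Type}
    (R : alpha -> relation A) (gamma beta : alpha) : relation A :=
  compose (clos_refl_trans A (below R gamma))
    (compose (clos_refl A (R beta))
             (clos_refl_trans A (below2 R gamma beta))).

Definition decreasingly_commute {alpha : ordinal} {A : Type}
    (R W : alpha -> relation A) : Prop :=
  forall (beta gamma : alpha) (a b c : A),
    R beta a c -> W gamma a b ->
    exists d, decreasing_side R gamma beta b d /\ decreasing_side W beta gamma c d.

Definition DC (alpha : ordinal) (A : ARS) : Prop :=
  exists R W : alpha -> relation A,
    same_relation A (Union R) (red A) /\
    same_relation A (Union W) (wred A) /\
    decreasingly_commute R W.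

Definition countable (A : ARS) : Prop :=
  exists f : A -> nat, Injective f.

Definition strict_subclass (P Q : ARS -> Prop) : Prop :=
  (forall A, P A -> Q A) /\ (exists A, Q A /\ ~ P A).

Definition union_DC_fin (A : ARS) : Prop := exists n : nat, DC (fin n) A.

Definition restrict_countable (P : ARS -> Prop) (A : ARS) : Prop :=
  countable A /\ P A.

(* Main.v *)
Require Import Defs.
From Stdlib Require Import Arith Lia List Classical.
Import ListNotations.

(** Both strictness witnesses live on the natural numbers: every [x > 0] has
    exactly one [->]-successor [f x < x] and one [~>]-successor [g x < x], so
    everything reduces to [0] on both sides, and labelling the edges out of [x]
    by [x] shows that the whole system is in [DC omega].

    The functions [f] and [g] are chosen so that the points are arranged in
    nested segments.  A segment of level [k+1] from [e+4] down to [t] consists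
    of three consecutive segments of level [k] from [e] down to [t], preceded by
    four points:
      [e+4 -> e+3 -> e+2 -> e],  [e+4 ~> e+2 ~> e+1 ~> e],
      [e+3 ~> t],  [e+1 -> t].
    The peak at [e+4] can only be closed at or below [t], along the [->]-path
    through the three inner segments; the peak at [e+2] only along the
    [~>]-path through them.  If all labels on the two paths through the outer
    segment are below [m], then on each of the two inner paths all labels but
    one are below [m-1], so one of the three inner segments has only labels
    below [m-1].  Hence a segment of level [k] needs more than [k] labels.

    Finally, admitting the sources of edges one at a time costs at most one
    additional label each, since the new edges can take a new largest label.
    Therefore some truncation of the system needs exactly [n+1] labels. *)

(** * Bounded natural labels *)

Lemma clos_rt_incl (A : Type) (R S : relation A) :
  inclusion A R S ->
  inclusion A (clos_refl_trans A R) (clos_refl_trans A S).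
Proof.
  intros h x y; induction 1 as [x y hxy | x | x y z _ IH1 _ IH2].
  - apply rt_step, h, hxy.
  - apply rt_refl.
  - exact (rt_trans _ _ _ _ _ IH1 IH2).
Qed.

(** The two label orders may differ, so this one monotonicity fact serves both for moving between
    [fin n] and [omega] and for adding edges. *)
Lemma decreasing_side_incl (alpha alpha' : ordinal) (A : Type)
    (R : alpha -> relation A) (S : alpha' -> relation A)
    (g b : alpha) (g' b' : alpha') :
  inclusion A (below R g) (below S g') ->
  inclusion A (below R b) (below S b') ->
  inclusion A (R b) (S b') ->
  inclusion A (decreasing_side R g b) (decreasing_side S g' b').
Proof.
  intros hg hb h x w [y [hxy [z [hyz hzw]]]].
  exists y; split; [exact (clos_rt_incl _ _ _ hg _ _ hxy) |].
  exists z; split.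
  - destruct hyz as [z hyz |]; [apply r_step, h, hyz | apply r_refl].
  - revert hzw; apply clos_rt_incl; intros u v [H | H].
    + left; exact (hg _ _ H).
    + right; exact (hb _ _ H).
Qed.

Definition bounded_labels {A : Type} (n : nat) (R : omega -> relation A) : Prop :=
  forall i x y, R i x y -> i < n.

Definition extend_labels {A : Type} (n : nat) (R : fin n -> relation A) :
    omega -> relation A :=
  fun i x y => exists h : i < n, R (exist _ i h) x y.

Lemma Union_extend_labels (A : Type) (n : nat) (R : fin n -> relation A)
    (S : relation A) :
  same_relation A (Union R) S -> same_relation A (Union (extend_labels n R)) S.
Proof.
  intros [h1 h2]; split.
  - intros x y [i [h H]]; apply h1; eexists; exact H.
  - intros x y H; destruct (h2 _ _ H) as [[i h] Hi]; exists i, h; exact Hi.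
Qed.

Lemma decreasing_side_extend_labels (A : Type) (n : nat)
    (R : fin n -> relation A) (i j : nat) (hi : i < n) (hj : j < n) :
  inclusion A (decreasing_side R (exist _ i hi) (exist _ j hj))
              (decreasing_side (extend_labels n R) i j).
Proof.
  apply decreasing_side_incl.
  - intros x y [[l hl] [H1 H2]]; exists l; split; [exact H1 | exists hl; exact H2].
  - intros x y [[l hl] [H1 H2]]; exists l; split; [exact H1 | exists hl; exact H2].
  - intros x y H; exists hj; exact H.
Qed.

Lemma decreasing_side_bounded (A : Type) (n : nat) (R : omega -> relation A)
    (i j : fin n) :
  bounded_labels n R ->
  inclusion A (decreasing_side R (proj1_sig i) (proj1_sig j))
              (decreasing_side (fun l : fin n => R (proj1_sig l)) i j).
Proof.
  intros hR; apply decreasing_side_incl.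
  - intros x y [l [H1 H2]]; exists (exist _ l (hR _ _ _ H2)); split; assumption.
  - intros x y [l [H1 H2]]; exists (exist _ l (hR _ _ _ H2)); split; assumption.
  - intros x y H; exact H.
Qed.

Lemma Union_bounded (A : Type) (n : nat) (R : omega -> relation A)
    (S : relation A) :
  bounded_labels n R -> same_relation A (Union R) S ->
  same_relation A (Union (fun l : fin n => R (proj1_sig l))) S.
Proof.
  intros hR [h1 h2]; split.
  - intros x y [i H]; apply h1; eexists; exact H.
  - intros x y H; destruct (h2 _ _ H) as [i Hi].
    exists (exist _ i (hR _ _ _ Hi)); exact Hi.
Qed.

(** Trades the subset type [fin n] for natural labels with a numeric bound, so that bounds can be
    compared and lowered by arithmetic. *)
Lemma DC_fin_bounded_labels (n : nat) (A : ARS) :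
  DC (fin n) A <->
  exists R W : omega -> relation A,
    bounded_labels n R /\ bounded_labels n W /\
    same_relation A (Union R) (red A) /\
    same_relation A (Union W) (wred A) /\
    decreasingly_commute R W.
Proof.
  split.
  - intros (R & W & hR & hW & hc).
    exists (extend_labels n R), (extend_labels n W).
    split; [intros i x y [h _]; exact h |].
    split; [intros i x y [h _]; exact h |].
    split; [exact (Union_extend_labels _ _ _ _ hR) |].
    split; [exact (Union_extend_labels _ _ _ _ hW) |].
    intros i j a b c [hi Hi] [hj Hj].
    destruct (hc _ _ _ _ _ Hi Hj) as [d [H1 H2]].
    exists d; split; eapply decreasing_side_extend_labels; eassumption.
  - intros (R & W & bR & bW & hR & hW & hc).
    exists (fun l : fin n => R (proj1_sig l)), (fun l : fin n => W (proj1_sig l)).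
    split; [exact (Union_bounded _ _ _ _ bR hR) |].
    split; [exact (Union_bounded _ _ _ _ bW hW) |].
    intros i j a b c Hi Hj.
    destruct (hc _ _ _ _ _ Hi Hj) as [d [H1 H2]].
    exists d; split; apply decreasing_side_bounded; assumption.
Qed.

Lemma DC_fin_le (n m : nat) (A : ARS) :
  n <= m -> DC (fin n) A -> DC (fin m) A.
Proof.
  intros hnm H; apply DC_fin_bounded_labels in H.
  destruct H as (R & W & bR & bW & H).
  apply DC_fin_bounded_labels; exists R, W.
  split; [intros i x y Hi; specialize (bR _ _ _ Hi); lia |].
  split; [intros i x y Hi; specialize (bW _ _ _ Hi); lia | exact H].
Qed.

Lemma DC_fin_omega (n : nat) (A : ARS) : DC (fin n) A -> DC omega A.
Proof.
  intros H; apply DC_fin_bounded_labels in H.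
  destruct H as (R & W & _ & _ & H); exists R, W; exact H.
Qed.

(** * Orbits of non-increasing functions *)

Definition orbit (f : nat -> nat) (x y : nat) : Prop :=
  exists i, y = Nat.iter i f x.

Lemma orbit_refl (f : nat -> nat) (x : nat) : orbit f x x.
Proof. exists 0; reflexivity. Qed.

Lemma orbit_trans (f : nat -> nat) (x y z : nat) :
  orbit f x y -> orbit f y z -> orbit f x z.
Proof.
  intros [i ->] [j ->]; exists (j + i); rewrite Nat.iter_add; reflexivity.
Qed.

Lemma orbit_step (f : nat -> nat) (x y z : nat) :
  f x = y -> orbit f y z -> orbit f x z.
Proof.
  intros <- [i ->]; exists (S i); rewrite Nat.iter_succ_r; reflexivity.
Qed.

Lemma orbit_inv (f : nat -> nat) (x z : nat) :
  orbit f x z -> z = x \/ orbit f (f x) z.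
Proof.
  intros [[| i] ->]; [left; reflexivity | right].
  exists i; rewrite Nat.iter_succ_r; reflexivity.
Qed.

Lemma orbit_le (f : nat -> nat) (x y : nat) :
  (forall z, f z <= z) -> orbit f x y -> y <= x.
Proof.
  intros hf [i ->]; induction i as [| i IH]; simpl; [lia |].
  specialize (hf (Nat.iter i f x)); lia.
Qed.

Lemma orbit_connect (f : nat -> nat) (x y z : nat) :
  (forall u, f u <= u) ->
  orbit f x y -> orbit f x z -> z <= y -> orbit f y z.
Proof.
  intros hf [i ->] [j ->] h.
  destruct (le_lt_dec i j) as [hij | hij].
  - exists (j - i); rewrite <- Nat.iter_add; f_equal; lia.
  (* Here [z] comes before [y] on the orbit, so [y <= z] and the two coincide. *)
  - assert (hle : Nat.iter i f x <= Nat.iter j f x).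
    { apply (orbit_le f); [exact hf |].
      exists (i - j); rewrite <- Nat.iter_add; f_equal; lia. }
    exists 0; simpl; lia.
Qed.

(** An edge may carry several labels; one below [m] suffices. *)
Definition labelled_below (R : omega -> relation nat) (f : nat -> nat)
    (m p : nat) : Prop :=
  exists l, l < m /\ R l p (f p).

(** Steps are deterministic, so a path runs along the orbit and uses the edge out of every orbit
    point above its end. *)
Lemma clos_rt_below_orbit (R : omega -> relation nat) (f : nat -> nat)
    (m x y : nat) :
  (forall u, f u <= u) -> (forall l u v, R l u v -> v = f u) ->
  clos_refl_trans nat (below R m) x y ->
  orbit f x y /\
  forall p, orbit f x p -> y < p -> labelled_below R f m p.
Proof.
  intros hf hR H; apply clos_rt_rt1n in H.
  induction H as [x | x z y hxz _ [IH1 IH2]].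
  - split; [apply orbit_refl |].
    intros p hp hlt; apply orbit_le in hp; [lia | exact hf].
  - destruct hxz as [l [hl hxz]].
    pose proof (hR _ _ _ hxz) as ez; subst z; split.
    + exact (orbit_step _ _ _ _ eq_refl IH1).
    + intros p hp hlt.
      destruct (orbit_inv _ _ _ hp) as [-> | hp']; [| exact (IH2 _ hp' hlt)].
      exists l; split; assumption.
Qed.

(* The exception [q] is the source of the one step with the opposite label. *)
Lemma decreasing_side_orbit (R : omega -> relation nat) (f : nat -> nat)
    (b c m x d : nat) :
  (forall u, f u <= u) -> (forall l u v, R l u v -> v = f u) ->
  b <= m -> c <= m ->
  @decreasing_side omega nat R b c x d ->
  orbit f x d /\
  exists q, forall p, orbit f x p -> d < p -> p <> q -> labelled_below R f m p.
Proof.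
  intros hf hR hb hc [y [hxy [z [hyz hzd]]]].
  assert (incl : forall l, l <= m ->
            inclusion nat (@below omega nat R l) (@below omega nat R m)).
  { intros l hl u v [i [hi Hi]]; exists i; split; [| exact Hi].
    simpl in *; lia. }
  apply (clos_rt_incl _ _ _ (incl b hb)) in hxy.
  assert (hzd' : clos_refl_trans nat (@below omega nat R m) z d).
  { revert hzd; apply clos_rt_incl.
    intros u v [H | H]; [exact (incl b hb _ _ H) | exact (incl c hc _ _ H)]. }
  destruct (clos_rt_below_orbit _ _ _ _ _ hf hR hxy) as [oxy lxy].
  destruct (clos_rt_below_orbit _ _ _ _ _ hf hR hzd') as [ozd lzd].
  assert (hz : z = y \/ z = f y).
  { destruct hyz as [z hyz |]; [right; exact (hR _ _ _ hyz) | left; reflexivity]. }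
  split.
  - apply (orbit_trans _ _ _ _ oxy).
    destruct hz as [-> | ->]; [exact ozd | exact (orbit_step _ _ _ _ eq_refl ozd)].
  - exists y; intros p hp hdp hpy.
    (* Sources above [y] are used by the first part of the side, those below [y] by the last
       part. *)
    destruct (le_lt_dec p y) as [hle | hlt]; [| exact (lxy _ hp hlt)].
    apply lzd; [| exact hdp].
    pose proof (orbit_connect _ _ _ _ hf oxy hp hle) as hyp.
    destruct hz as [-> | ->]; [exact hyp |].
    destruct (orbit_inv _ _ _ hyp) as [e | h]; [contradiction | exact h].
Qed.

(** * Nested segments *)

Inductive segment (f g : nat -> nat) : nat -> nat -> nat -> Prop :=
| segment_O t :
    f (S t) = t -> g (S t) = t -> segment f g 0 t (S t)
| segment_S k t e1 e2 e :
    segment f g k t e1 -> segment f g k e1 e2 -> segment f g k e2 e ->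
    f (1 + e) = t -> g (1 + e) = e ->
    f (2 + e) = e -> g (2 + e) = 1 + e ->
    f (3 + e) = 2 + e -> g (3 + e) = t ->
    f (4 + e) = 3 + e -> g (4 + e) = 2 + e ->
    segment f g (S k) t (4 + e).

Lemma segment_orbit (f g : nat -> nat) (k t s : nat) :
  segment f g k t s -> t < s /\ orbit f s t /\ orbit g s t.
Proof.
  induction 1 as [t hf hg | k t e1 e2 e _ (l1 & f1 & g1) _ (l2 & f2 & g2)
                  _ (l3 & f3 & g3) a1 b1 a2 b2 a3 b3 a4 b4].
  - split; [lia |].
    split; eapply orbit_step; try eassumption; apply orbit_refl.
  - split; [lia |]; split.
    + apply (orbit_step _ _ _ _ a4), (orbit_step _ _ _ _ a3),
        (orbit_step _ _ _ _ a2), (orbit_trans _ _ _ _ f3),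
        (orbit_trans _ _ _ _ f2), f1.
    + apply (orbit_step _ _ _ _ b4), (orbit_step _ _ _ _ b2),
        (orbit_step _ _ _ _ b1), (orbit_trans _ _ _ _ g3),
        (orbit_trans _ _ _ _ g2), g1.
Qed.

(** Pigeonhole: two exceptional sources, one per relation, cannot meet three disjoint intervals.
    This is why segments are tripled. *)
Lemma interval_avoiding_two (t e1 e2 e q q' : nat) :
  t < e1 -> e1 < e2 -> e2 < e ->
  (forall p, t < p <= e1 -> p <> q /\ p <> q') \/
  (forall p, e1 < p <= e2 -> p <> q /\ p <> q') \/
  (forall p, e2 < p <= e -> p <> q /\ p <> q').
Proof.
  intros h1 h2 h3.
  destruct (le_lt_dec q e1), (le_lt_dec q e2), (le_lt_dec q' e1),
    (le_lt_dec q' e2); try lia;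
    solve [ left; intros; lia | right; left; intros; lia
          | right; right; intros; lia ].
Qed.

(** Induction on the segment with [m] left general, since an inner segment is used with the bound
    [pred m]. *)
Lemma segment_level_lt (R W : omega -> relation nat) (f g : nat -> nat) :
  (forall u, f u <= u) -> (forall u, g u <= u) ->
  (forall l u v, R l u v -> v = f u) -> (forall l u v, W l u v -> v = g u) ->
  decreasingly_commute R W ->
  forall k t s, segment f g k t s ->
  forall m,
  (forall p, orbit f s p -> t < p -> labelled_below R f m p) ->
  (forall p, orbit g s p -> t < p -> labelled_below W g m p) ->
  k < m.
Proof.
  intros hf hg hR hW hc k t s H.
  induction H as [t _ _ | k t e1 e2 e S1 IH1 S2 IH2 S3 IH3
                  a1 b1 a2 b2 a3 b3 a4 b4]; intros m LR LW.
  - destruct (LR (S t)) as [l [hl _]]; [apply orbit_refl | lia | lia].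
  - destruct (segment_orbit _ _ _ _ _ S1) as (l1 & f1 & g1).
    destruct (segment_orbit _ _ _ _ _ S2) as (l2 & f2 & g2).
    destruct (segment_orbit _ _ _ _ _ S3) as (l3 & f3 & g3).
    assert (LR' : exists q, forall p, orbit f e p -> t < p -> p <> q ->
                    labelled_below R f (pred m) p).
    { destruct (LR (4 + e)) as [b [hb Hb]]; [apply orbit_refl | lia |].
      destruct (LW (4 + e)) as [c [hc' Hc]]; [apply orbit_refl | lia |].
      destruct (hc _ _ _ _ _ Hb Hc) as [d [D1 D2]].
      rewrite b4 in D1; rewrite a4 in D2.
      (* Both [b] and [c] are at most [pred m], so labels below either of them are below
         [pred m]. *)
      destruct (decreasing_side_orbit R f c b (pred m) (2 + e) d hf hR)
        as [o1 [q hq]]; [lia | lia | exact D1 |].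
      destruct (decreasing_side_orbit W g b c (pred m) (3 + e) d hg hW)
        as [o2 _]; [lia | lia | exact D2 |].
      apply orbit_le in o1; [| exact hf].
      (* As [d <= 2 + e], the [g]-side must leave [3 + e], and its first step already lands on
         [t]. *)
      assert (hd : d <= t).
      { destruct (orbit_inv _ _ _ o2) as [-> | o3]; [lia |].
        rewrite b3 in o3; exact (orbit_le _ _ _ hg o3). }
      exists q; intros p hp htp hpq.
      apply hq; [exact (orbit_step _ _ _ _ a2 hp) | lia | exact hpq]. }
    assert (LW' : exists q, forall p, orbit g e p -> t < p -> p <> q ->
                    labelled_below W g (pred m) p).
    (* The point [2 + e] lies on both outer paths, so its peak also has labels below [m]; now the
       [f]-side is forced from [1 + e] to [t]. *)
    { destruct (LR (2 + e)) as [b [hb Hb]].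
      { apply (orbit_step _ _ _ _ a4), (orbit_step _ _ _ _ a3), orbit_refl. }
      { lia. }
      destruct (LW (2 + e)) as [c [hc' Hc]].
      { apply (orbit_step _ _ _ _ b4), orbit_refl. }
      { lia. }
      destruct (hc _ _ _ _ _ Hb Hc) as [d [D1 D2]].
      rewrite b2 in D1; rewrite a2 in D2.
      destruct (decreasing_side_orbit R f c b (pred m) (1 + e) d hf hR)
        as [o1 _]; [lia | lia | exact D1 |].
      destruct (decreasing_side_orbit W g b c (pred m) e d hg hW)
        as [o2 [q hq]]; [lia | lia | exact D2 |].
      apply orbit_le in o2; [| exact hg].
      assert (hd : d <= t).
      { destruct (orbit_inv _ _ _ o1) as [-> | o3]; [lia |].
        rewrite a1 in o3; exact (orbit_le _ _ _ hf o3). }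
      exists q; intros p hp htp hpq.
      apply hq; [exact hp | lia | exact hpq]. }
    destruct LR' as [q hq], LW' as [q' hq'].
    enough (k < pred m) by lia.
    (* The inner segment avoiding [q] and [q'] has both paths labelled below [pred m]. *)
    destruct (interval_avoiding_two t e1 e2 e q q' l1 l2 l3)
      as [av | [av | av]]; [apply IH1 | apply IH2 | apply IH3];
      intros p hp htp.
    + pose proof (orbit_le _ _ _ hf hp).
      apply hq; [| lia | apply av; lia].
      apply (orbit_trans _ _ _ _ f3), (orbit_trans _ _ _ _ f2), hp.
    + pose proof (orbit_le _ _ _ hg hp).
      apply hq'; [| lia | apply av; lia].
      apply (orbit_trans _ _ _ _ g3), (orbit_trans _ _ _ _ g2), hp.
    + pose proof (orbit_le _ _ _ hf hp).
      apply hq; [| lia | apply av; lia].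
      apply (orbit_trans _ _ _ _ f3), hp.
    + pose proof (orbit_le _ _ _ hg hp).
      apply hq'; [| lia | apply av; lia].
      apply (orbit_trans _ _ _ _ g3), hp.
    + pose proof (orbit_le _ _ _ hf hp).
      apply hq; [exact hp | lia | apply av; lia].
    + pose proof (orbit_le _ _ _ hg hp).
      apply hq'; [exact hp | lia | apply av; lia].
Qed.

(* A segment of level [k] is coded, from its lowest source upwards, by the pairs
   [(u, v)] such that a source [x] has successors [x - S u] and [x - S v];
   relative offsets make the code independent of the position. *)
Fixpoint segment_code (k : nat) : list (nat * nat) :=
  match k with
  | 0 => [(0, 0)]
  | S k =>
      let c := segment_code k ++ segment_code k ++ segment_code k in
      c ++ [(length c, 0); (1, 0); (0, 2 + length c); (0, 1)]
  end.

Lemma segment_code_length (k : nat) : k < length (segment_code k).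
Proof.
  induction k as [| k IH]; simpl; [lia |].
  rewrite !length_app; simpl; lia.
Qed.

(** Each code begins with the previous one, so all levels are prefixes of a single infinite
    sequence. *)
Lemma segment_code_prefix (k j : nat) :
  exists c, segment_code (j + k) = segment_code k ++ c.
Proof.
  induction j as [| j [c IH]].
  - exists []; rewrite app_nil_r; reflexivity.
  - eexists; cbn [Nat.add segment_code]; rewrite IH.
    rewrite <- !app_assoc; reflexivity.
Qed.

Lemma nth_segment_code (k j i : nat) (z : nat * nat) :
  k <= j -> i < length (segment_code k) ->
  nth i (segment_code j) z = nth i (segment_code k) z.
Proof.
  intros hkj hi; destruct (segment_code_prefix k (j - k)) as [c hc].
  replace (j - k + k) with j in hc by lia.
  rewrite hc; apply app_nth1, hi.
Qed.

(** Entry [pred x] of that infinite sequence, as sources start at 1. Level [x] is long enough to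
    contain it, so the default is never read. *)
Definition offset (x : nat) : nat * nat :=
  nth (pred x) (segment_code x) (0, 0).

Definition fsucc (x : nat) : nat := x - S (fst (offset x)).
Definition gsucc (x : nat) : nat := x - S (snd (offset x)).

Lemma segment_of_code (k t : nat) :
  (forall i, i < length (segment_code k) ->
     offset (S (t + i)) = nth i (segment_code k) (0, 0)) ->
  segment fsucc gsucc k t (t + length (segment_code k)).
Proof.
  revert t; induction k as [| k IH]; intros t h.
  - specialize (h 0 ltac:(simpl; lia)); rewrite Nat.add_0_r in h.
    simpl length; rewrite Nat.add_1_r.
    apply segment_O; unfold fsucc, gsucc; rewrite h; simpl; lia.
  - cbn [segment_code] in *.
    set (n := length (segment_code k)) in *.
    set (c := segment_code k ++ segment_code k ++ segment_code k) in *.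
    assert (hlen : length c = n + (n + n)).
    { unfold c; rewrite !length_app; reflexivity. }
    rewrite length_app in *; simpl length in *.
    assert (hc : forall i, i < length c ->
              offset (S (t + i)) = nth i c (0, 0)).
    { intros i hi; rewrite h by lia; apply app_nth1, hi. }
    (* The four extra sources sit above [e = t + length c], listed upwards; the entries involving
       [length c] jump to [t]. *)
    assert (hd : forall i, i < 4 -> offset (S i + (t + length c)) =
              nth i [(length c, 0); (1, 0); (0, 2 + length c); (0, 1)] (0, 0)).
    { intros i hi; replace (S i + (t + length c)) with (S (t + (length c + i))) by lia.
      rewrite h by lia; rewrite app_nth2 by lia; f_equal; lia. }
    replace (t + (length c + 4)) with (4 + (t + length c)) by lia.
    apply segment_S with (e1 := t + n) (e2 := t + n + n).
    + apply IH; intros i hi; rewrite hc by lia.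
      unfold c; apply app_nth1, hi.
    + apply IH; intros i hi.
      replace (t + n + i) with (t + (n + i)) by lia; rewrite hc by lia.
      unfold c; rewrite app_nth2 by lia; fold n.
      replace (n + i - n) with i by lia; apply app_nth1, hi.
    + replace (t + length c) with (t + n + n + n) by lia.
      apply IH; intros i hi.
      replace (t + n + n + i) with (t + (n + (n + i))) by lia; rewrite hc by lia.
      unfold c; rewrite !app_nth2 by lia; fold n; f_equal; lia.
    + unfold fsucc; rewrite (hd 0) by lia; simpl; lia.
    + unfold gsucc; rewrite (hd 0) by lia; simpl; lia.
    + unfold fsucc; rewrite (hd 1) by lia; simpl; lia.
    + unfold gsucc; rewrite (hd 1) by lia; simpl; lia.
    + unfold fsucc; rewrite (hd 2) by lia; simpl; lia.
    + unfold gsucc; rewrite (hd 2) by lia; cbn [nth snd]; lia.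
    + unfold fsucc; rewrite (hd 3) by lia; simpl; lia.
    + unfold gsucc; rewrite (hd 3) by lia; simpl; lia.
Qed.

Lemma segment_exists (k : nat) : exists s, segment fsucc gsucc k 0 s.
Proof.
  exists (0 + length (segment_code k)); apply segment_of_code.
  intros i hi; unfold offset; simpl pred; rewrite Nat.add_0_l.
  pose proof (segment_code_length (S i)).
  (* [offset] reads the code of level [S i]; whichever of the levels [k] and [S i] is smaller gives
     a prefix of the other. *)
  destruct (le_lt_dec k (S i)).
  - apply nth_segment_code; assumption.
  - symmetry; apply nth_segment_code; lia.
Qed.

(** * The separating systems *)

(** [P] selects the sources that keep their edges. The carrier stays [nat], so truncating only
    removes edges. *)
Definition staircase (P : nat -> Prop) : ARS :=
  mkARS nat (inhabits 0)
    (fun x y => P x /\ 0 < x /\ y = fsucc x)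
    (fun x y => P x /\ 0 < x /\ y = gsucc x).

Lemma countable_staircase (P : nat -> Prop) : countable (staircase P).
Proof. exists (fun x => x); intros x y h; exact h. Qed.

Lemma fsucc_lt (x : nat) : 0 < x -> fsucc x < x.
Proof. unfold fsucc; lia. Qed.

Lemma gsucc_lt (x : nat) : 0 < x -> gsucc x < x.
Proof. unfold gsucc; lia. Qed.

(** With labels below [n] throughout, the bound on the level of the segment would read [n < n]. *)
Lemma staircase_not_DC_fin (P : nat -> Prop) (n s : nat) :
  segment fsucc gsucc n 0 s -> (forall p, p <= s -> P p) ->
  ~ DC (fin n) (staircase P).
Proof.
  intros hs hP H; apply DC_fin_bounded_labels in H.
  destruct H as (R & W & bR & bW & [R1 R2] & [W1 W2] & hc).
  assert (hf : forall u, fsucc u <= u) by (intros u; unfold fsucc; lia).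
  assert (hg : forall u, gsucc u <= u) by (intros u; unfold gsucc; lia).
  apply (Nat.lt_irrefl n).
  apply (segment_level_lt R W fsucc gsucc hf hg) with (t := 0) (s := s);
    [| | exact hc | exact hs | |].
  - intros l u v H; destruct (R1 u v (ex_intro _ l H)) as (_ & _ & e); exact e.
  - intros l u v H; destruct (W1 u v (ex_intro _ l H)) as (_ & _ & e); exact e.
  - intros p hp h0; apply orbit_le in hp; [| exact hf].
    destruct (R2 p (fsucc p)) as [l Hl]; [simpl; auto |].
    exists l; split; [exact (bR _ _ _ Hl) | exact Hl].
  - intros p hp h0; apply orbit_le in hp; [| exact hg].
    destruct (W2 p (gsucc p)) as [l Hl]; [simpl; auto |].
    exists l; split; [exact (bW _ _ _ Hl) | exact Hl].
Qed.

(** * Decreasing labellings of the systems *)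

Lemma clos_rt_descend (S : relation nat) (b : nat) :
  (forall x, 0 < x <= b -> exists y, y < x /\ S x y) ->
  clos_refl_trans nat S b 0.
Proof.
  induction b as [b IH] using lt_wf_ind; intros h.
  destruct b as [| b]; [apply rt_refl |].
  destruct (h (Datatypes.S b)) as [y [hy Hy]]; [lia |].
  apply rt_trans with y; [apply rt_step, Hy |].
  apply IH; [exact hy |]; intros x hx; apply h; lia.
Qed.

(** The first part of the side descends all the way to 0; the other two are empty. *)
Lemma decreasing_side_descend (R : omega -> relation nat) (i j b : nat) :
  (forall x, 0 < x <= b -> exists y, y < x /\ @below omega nat R i x y) ->
  @decreasing_side omega nat R i j b 0.
Proof.
  intros h; exists 0; split; [exact (clos_rt_descend _ _ h) |].
  exists 0; split; [apply r_refl | apply rt_refl].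
Qed.

Lemma staircase_DC_omega : DC omega (staircase (fun _ => True)).
Proof.
  exists (fun i x y => x = i /\ 0 < x /\ y = fsucc x),
    (fun i x y => x = i /\ 0 < x /\ y = gsucc x).
  split; [| split].
  - split; [intros x y [i [_ h]]; simpl; auto | intros x y [_ h]; exists x; auto].
  - split; [intros x y [i [_ h]]; simpl; auto | intros x y [_ h]; exists x; auto].
  - intros i j a b c (<- & h0 & ->) (<- & _ & ->).
    pose proof (fsucc_lt a h0); pose proof (gsucc_lt a h0).
    exists 0; split; apply decreasing_side_descend; intros x hx.
    + exists (fsucc x); split; [apply fsucc_lt; lia |].
      exists x; split; [simpl; lia | repeat split; lia].
    + exists (gsucc x); split; [apply gsucc_lt; lia |].
      exists x; split; [simpl; lia | repeat split; lia].
Qed.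

Lemma staircase_0_DC : DC (fin 0) (staircase (fun x => x <= 0)).
Proof.
  exists (fun _ _ _ => False), (fun _ _ _ => False).
  split; [| split].
  - split; [intros x y [i []] | intros x y [h1 [h2 _]]; lia].
  - split; [intros x y [i []] | intros x y [h1 [h2 _]]; lia].
  - intros i j a b c [].
Qed.

Definition add_source (R : omega -> relation nat) (n N y : nat) :
    omega -> relation nat :=
  fun i u v => R i u v \/ (i = n /\ u = N /\ v = y).

Lemma Union_add_source (R : omega -> relation nat) (f : nat -> nat) (n N : nat) :
  same_relation nat (Union R) (fun x y => x <= N /\ 0 < x /\ y = f x) ->
  same_relation nat (Union (add_source R n (S N) (f (S N))))
    (fun x y => x <= S N /\ 0 < x /\ y = f x).
Proof.
  intros [h1 h2]; split.
  - intros x y [i [H | (_ & -> & ->)]]; [| repeat split; lia].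
    destruct (h1 x y (ex_intro _ i H)) as (? & ? & ?); repeat split; [lia | |]; assumption.
  - intros x y (hx & h0 & ->).
    destruct (Nat.eq_dec x (S N)) as [-> | hn].
    + exists n; right; auto.
    + destruct (h2 x (f x)) as [i Hi]; [repeat split; lia |].
      exists i; left; exact Hi.
Qed.

Lemma decreasing_side_add_source (R : omega -> relation nat) (n N y i j : nat) :
  inclusion nat (@decreasing_side omega nat R i j)
                (@decreasing_side omega nat (add_source R n N y) i j).
Proof.
  apply decreasing_side_incl.
  - intros u v [l [h H]]; exists l; split; [exact h | left; exact H].
  - intros u v [l [h H]]; exists l; split; [exact h | left; exact H].
  - intros u v H; left; exact H.
Qed.

(** All old labels lie below the new label [n], so the old edges alone may be used to descend to
    0. *)
Lemma decreasing_side_new_source (R : omega -> relation nat) (f : nat -> nat)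
    (n N y j b : nat) :
  (forall x, 0 < x -> f x < x) -> bounded_labels n R ->
  same_relation nat (Union R) (fun x y => x <= N /\ 0 < x /\ y = f x) ->
  b <= N ->
  @decreasing_side omega nat (add_source R n (S N) y) n j b 0.
Proof.
  intros hf bR [_ h2] hb; apply decreasing_side_add_source.
  apply decreasing_side_descend; intros x hx.
  exists (f x); split; [apply hf; lia |].
  destruct (h2 x (f x)) as [l Hl]; [repeat split; lia |].
  exists l; split; [exact (bR _ _ _ Hl) | exact Hl].
Qed.

Lemma staircase_DC_S (n N : nat) :
  DC (fin n) (staircase (fun x => x <= N)) ->
  DC (fin (S n)) (staircase (fun x => x <= S N)).
Proof.
  intros H; apply DC_fin_bounded_labels in H.
  destruct H as (R & W & bR & bW & hR & hW & hc).
  apply DC_fin_bounded_labels.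
  exists (add_source R n (S N) (fsucc (S N))), (add_source W n (S N) (gsucc (S N))).
  split; [intros i x y [h | [-> _]]; [specialize (bR _ _ _ h) |]; lia |].
  split; [intros i x y [h | [-> _]]; [specialize (bW _ _ _ h) |]; lia |].
  split; [exact (Union_add_source _ _ _ _ hR) |].
  split; [exact (Union_add_source _ _ _ _ hW) |].
  intros i j a b c HR HW.
  destruct HR as [HR | (-> & -> & ->)], HW as [HW | (ej & ea & ->)].
  - destruct (hc _ _ _ _ _ HR HW) as [d [D1 D2]].
    exists d; split; apply decreasing_side_add_source; assumption.
  (* Old and new edges never form a peak: old sources are at most [N], the new one is [S N]. *)
  - destruct (proj1 hR _ _ (ex_intro _ i HR)) as [h _]; simpl in h; lia.
  - destruct (proj1 hW _ _ (ex_intro _ j HW)) as [h _]; simpl in h; lia.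
  - subst j.
    pose proof (fsucc_lt (S N) ltac:(lia)); pose proof (gsucc_lt (S N) ltac:(lia)).
    exists 0; split.
    + apply (decreasing_side_new_source R fsucc); auto using fsucc_lt; lia.
    + apply (decreasing_side_new_source W gsucc); auto using gsucc_lt; lia.
Qed.

(** Descend from a truncation outside [DC (fin n)] until the next smaller one is inside; restoring
    one source then costs one label. Truncation at 0 has no edges, so the descent stops. *)
Lemma DC_fin_S_witness (n : nat) :
  exists A, countable A /\ DC (fin (S n)) A /\ ~ DC (fin n) A.
Proof.
  assert (H : forall N, ~ DC (fin n) (staircase (fun x => x <= N)) ->
     exists M, DC (fin (S n)) (staircase (fun x => x <= M)) /\
               ~ DC (fin n) (staircase (fun x => x <= M))).
  { induction N as [| N IH]; intros h.
    - destruct h; apply (DC_fin_le 0 n); [lia | exact staircase_0_DC].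
    - destruct (classic (DC (fin n) (staircase (fun x => x <= N)))) as [d | d].
      + exists (S N); split; [exact (staircase_DC_S _ _ d) | exact h].
      + exact (IH d). }
  destruct (segment_exists n) as [s hs].
  destruct (H s) as [M hM].
  - apply (staircase_not_DC_fin _ n s hs); auto.
  - exists (staircase (fun x => x <= M)); split; [apply countable_staircase | exact hM].
Qed.

Lemma DC_omega_witness :
  exists A, countable A /\ DC omega A /\ ~ union_DC_fin A.
Proof.
  exists (staircase (fun _ => True)).
  split; [apply countable_staircase |].
  split; [exact staircase_DC_omega |].
  intros [n h]; destruct (segment_exists n) as [s hs].
  revert h; apply (staircase_not_DC_fin _ n s hs); auto.
Qed.

Lemma union_DC_fin_DC_omega (A : ARS) : union_DC_fin A -> DC omega A.
Proof. intros [n h]; exact (DC_fin_omega n A h). Qed.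

(** One countable witness separates the full classes and their restrictions alike. *)
Lemma strict_subclass_countable (P Q : ARS -> Prop) :
  (forall A, P A -> Q A) -> (exists A, countable A /\ Q A /\ ~ P A) ->
  strict_subclass P Q /\
  strict_subclass (restrict_countable P) (restrict_countable Q).
Proof.
  intros hPQ (A & hA & hQ & hP); split; split.
  - exact hPQ.
  - exists A; auto.
  - intros B [hB h]; split; auto.
  - exists A; split; [split; assumption | intros [_ h]; exact (hP h)].
Qed.

Theorem theorem5p10 :
  (forall n : nat, strict_subclass (DC (fin n)) (DC (fin (S n)))) /\
  strict_subclass union_DC_fin (DC omega) /\
  (forall n : nat,
      strict_subclass (restrict_countable (DC (fin n)))
                      (restrict_countable (DC (fin (S n))))) /\
  strict_subclass (restrict_countable union_DC_fin)
                  (restrict_countable (DC omega)).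
Proof.
  pose proof (fun n => strict_subclass_countable (DC (fin n)) (DC (fin (S n)))
    (fun A => DC_fin_le n (S n) A (Nat.le_succ_diag_r n)) (DC_fin_S_witness n)) as H.
  destruct (strict_subclass_countable _ _ union_DC_fin_DC_omega DC_omega_witness)
    as [h1 h2].
  split; [intros n; apply H |].
  split; [exact h1 |].
  split; [intros n; apply H | exact h2].
Qed.
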